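(* Let $c>0$. There is a constant $C=C(c)$ such that the following holds. Let $p\ge 2$ be an integer and let $\mathcal{F}$ be a finite family of $n$ nonempty subsets (''regions'') of $\mathbb{R}^d$ whose dual hypergraph has a hereditarily $c$-linear Delaunay graph. If $\mathcal{F}$ satisfies the $(p,2)$-property, then $\mathcal{F}$ admits a transversal of size at most $C\,p\log p$ (i.e., of size $O(p\log p)$).
   Context: A hypergraph $H=(V,\mathcal{E})$ consists of a finite vertex set $V$ and a collection $\mathcal{E}$ of subsets of $V$. For $S\subseteq V$, $H|_S=(S,\{e\cap S: e\in\mathcal{E}\})$. The Delaunay graph of $H$ is the graph on $V$ whose edges are the hyperedges of size exactly $2$. $H$ has a hereditarily $c$-linear Delaunay graph if for every nonempty $S\subseteq V$ the Delaunay graph of $H|_S$ has fewer than $c|S|$ edges. The dual hypergraph of a family $\mathcal{F}$ of subsets of $\mathbb{R}^d$ has vertex set $\mathcal{F}$ and, for each $x\in\mathbb{R}^d$, the hyperedge $e_x=\{B\in\mathcal{F}: x\in B\}$. $\mathcal{F}$ satisfies the $(p,2)$-property if among any $p$ members of $\mathcal{F}$ some two have nonempty intersection. A transversal of $\mathcal{F}$ is a set of points of $\mathbb{R}^d$ meeting every member of $\mathcal{F}$. *)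

(* Defs.v *)
From HB Require Import structures.
From mathcomp Require Import all_boot all_order all_algebra.
From mathcomp Require Import boolp classical_sets reals exp.
Set Implicit Arguments. Unset Strict Implicit. Unset Printing Implicit Defensive.
Import Order.TTheory GRing.Theory Num.Theory.
Local Open Scope ring_scope.
Local Open Scope classical_set_scope.

(* Points of R^d are row vectors 'rV[R]_d.  A finite family of n regions is
   F : 'I_n -> set 'rV[R]_d (vertices of the dual hypergraph are the indices). *)

Definition dual_edge_in (R : realType) (d n : nat) (F : 'I_n -> set 'rV[R]_d)
  (S : {set 'I_n}) (x : 'rV[R]_d) : {set 'I_n} :=
  [set i in S | `[< F i x >]].

Definition delaunay_edges (R : realType) (d n : nat) (F : 'I_n -> set 'rV[R]_d)
  (S : {set 'I_n}) : {set {set 'I_n}} :=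
  [set E : {set 'I_n} | (#|E| == 2)%N && `[< exists x, dual_edge_in F S x = E >]].

Definition hered_c_linear_delaunay (R : realType) (c : R) (d n : nat)
  (F : 'I_n -> set 'rV[R]_d) : Prop :=
  forall S : {set 'I_n}, (0 < #|S|)%N ->
    (#|delaunay_edges F S|%:R < c * #|S|%:R)%R.

Definition p2_property (R : realType) (d n p : nat) (F : 'I_n -> set 'rV[R]_d) : Prop :=
  forall S : {set 'I_n}, #|S| = p ->
    exists i j, [/\ i \in S, j \in S, i != j & F i `&` F j !=set0].

Definition is_transversal_pts (R : realType) (d n : nat) (F : 'I_n -> set 'rV[R]_d)
  (T : seq 'rV[R]_d) : Prop :=
  forall i, exists2 x, x \in T & F i x.

(* Main.v *)
Require Import Defs.
From HB Require Import structures.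
From mathcomp Require Import all_boot zify.
Set Implicit Arguments. Unset Strict Implicit. Unset Printing Implicit Defensive.

(* Fractional step: draw t = O(p) regions at random from any multiset of regions.
   By the (p,2)-property and Turan, Omega(t^2/p) pairs of draws intersect.  If no
   point had depth 1/(2t), then for half of these pairs, on average, a witness
   point would avoid all other draws, giving more Delaunay edges on the sample than
   linearity allows.  So every weighting of the regions has a point of relative
   depth Omega(1/p), and multiplicative weights turn this into a multiset of points
   meeting every region with frequency Omega(1/p).

   Rounding step: a large set of points shattered by the regions would contain, for
   suitable regions B_1, ..., B_k, a point lying exactly in B_i and B_j for all i, j,
   so that the Delaunay graph on them is complete.  Hence the traces of the regions
   on m points are polynomially many in m (Pajor, Sauer-Shelah), and double sampling
   gives a net of size O(p log p). *)

(** * Intersecting pairs in a sample, and resampling of one draw *)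

(* Remove a maximal independent set, of size at most q: every remaining vertex has
   a neighbour in it.  Iterate k times. *)
Lemma turan_pairs (T : finType) (r : rel T) (q : nat) :
    symmetric r -> irreflexive r ->
    (forall S : {set T}, #|S| = q.+1 -> exists i j, [/\ i \in S, j \in S & r i j]) ->
  forall (k : nat) (S : {set T}),
    k * (#|S| - k * q) <= \sum_(i in S) \sum_(j in S) r i j.
Proof.
move=> rC rI rP; elim=> [|k IH] S; first by rewrite mul0n.
pose ind (I : {set T}) := (I \subset S) && [forall i in I, forall j in I, ~~ r i j].
have ind0 : ind set0.
  by rewrite /ind sub0set; apply/forall_inP => i; rewrite inE.
have [I /maxsetP[/andP[IS /forall_inP Iind] Imax] _] := maxset_exists ind0.
have Iq : #|I| <= q.
  rewrite leqNgt; apply/negP => /card_geqP[s [us ss sI]].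
  have [] := rP [set:: s].
    by rewrite cardsE (card_uniqP us) ss.
  move=> i [j []]; rewrite !inE => /sI iI /sI jI rij.
  by have /forall_inP/(_ j jI) := Iind i iI; rewrite rij.
set S' := (S :\: I).
have cS' : #|S| - q <= #|S'|.
  by rewrite /S' cardsD; move/setIidPr: IS => ->; lia.
have nbr i : i \in S' -> 1 <= \sum_(j in I) r i j.
  rewrite inE => /andP[iI iS].
  rewrite lt0n; apply/eqP => s0.
  have i0 j : j \in I -> ~~ r i j.
    move=> jI; move/eqP: s0; rewrite sum_nat_eq0 => /forall_inP/(_ j jI).
    by case: (r i j).
  have : ind (i |: I).
    rewrite /ind subUset sub1set iS IS /=.
    apply/forall_inP => a; rewrite !inE => aI.
    apply/forall_inP => b; rewrite !inE => bI.
    case/orP: aI => [/eqP->|aI]; case/orP: bI => [/eqP->|bI].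
    - by rewrite rI.
    - exact: i0.
    - by rewrite rC; exact: i0.
    - by have /forall_inP := Iind a aI; apply.
  move/Imax => /(_ (subsetUr _ _)) eI.
  by move: iI; rewrite -eI !inE eqxx.
have H : \sum_(i in S') \sum_(j in S') r i j + #|S'|
          <= \sum_(i in S) \sum_(j in S) r i j.
  rewrite -sum1_card -big_split /=.
  rewrite [leqRHS](big_setID I) /=; apply: leq_trans (leq_addl _ _).
  apply: leq_sum => i iS'.
  rewrite [leqRHS](big_setID I) /= addnC.
  by move/setIidPr: IS => ->; rewrite leq_add2r nbr.
apply: leq_trans H; apply: leq_trans (leq_add (IH S') cS').
have := leq_mul2l k (#|S| - q - k * q) (#|S'| - k * q).
by rewrite leq_sub2r // orbT => h; rewrite mulSn -subnDA mulSn in h *; lia.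
Qed.

(* A fresh value u can be exchanged with the sampled value f l. *)
Lemma resample (I U : finType) (l : I) (h : {ffun I -> U} -> U -> nat) :
    (forall f f' : {ffun I -> U}, (forall i, i != l -> f i = f' i) -> h f =1 h f') ->
  #|U| * \sum_f h f (f l) = \sum_f \sum_u h f u.
Proof.
move=> hl.
pose sw (z : {ffun I -> U} * U) :=
  ([ffun i => if i == l then z.2 else z.1 i], z.1 l) : {ffun I -> U} * U.
have swK : involutive sw.
  case=> f u; rewrite /sw /= ffunE eqxx; congr pair.
  by apply/ffunP => i; rewrite !ffunE; case: eqP => // ->.
rewrite [RHS]pair_big /= [RHS](reindex_inj (inv_inj swK)) /=.
rewrite -(pair_big predT predT (fun f u => h (sw (f, u)).1 (f l))) /=.
rewrite big_distrr /=; apply: eq_bigr => f _.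
rewrite -sum_nat_const; apply: eq_bigr => u _.
by apply: hl => i /negPf il; rewrite ffunE il.
Qed.

(** * Delaunay graphs of abstract hypergraphs *)

Definition hyp_delaunay (V : finType) (E : {set {set V}}) (S : {set V}) :=
  [set A : {set V} | (#|A| == 2) && (A \in [set e :&: S | e in E])].

(** Non-strict form with an integer constant; the real constant of the theorem is rounded up to
    it. *)
Definition hered_linear (V : finType) (E : {set {set V}}) (c : nat) :=
  forall S : {set V}, 0 < #|S| -> #|hyp_delaunay E S| <= c * #|S|.

(** Each Delaunay edge [A] accounts for at most the 4 ordered pairs of [setX A A]. *)
Lemma delaunay_pairs (V : finType) (E : {set {set V}}) (c : nat) (S : {set V})
    (P : {set V * V}) :
    hered_linear E c -> 0 < #|S| ->
    (forall v w, (v, w) \in P -> v != w /\ exists2 e, e \in E & e :&: S = [set v; w]) ->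
  #|P| <= 4 * c * #|S|.
Proof.
move=> lin S0 hP; apply: (@leq_trans (4 * #|hyp_delaunay E S|)); last first.
  by rewrite -mulnA leq_mul2l lin.
apply: (@leq_trans #|\bigcup_(A in hyp_delaunay E S) setX A A|).
  apply/subset_leq_card/subsetP => -[v w] /hP[vw [e eE eS]].
  apply/bigcupP; exists [set v; w]; last by rewrite !inE !eqxx orbT.
  by rewrite inE cards2 vw -eS; apply: imset_f.
rewrite mulnC -sum_nat_const.
elim/big_rec2: _ => [|A m B]; first by rewrite cards0.
rewrite inE => /andP[/eqP A2 _] IH; apply: leq_trans (leq_card_setU _ _) _.
by rewrite cardsX A2 leq_add2l.
Qed.

(** * Fractional step: a hyperedge of relative weight Omega(1/q) *)

Section HeavyEdge.
Variables (V U : finType) (E : {set {set V}}) (c q : nat) (g : U -> V).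
Hypothesis lin : hered_linear E c.
Hypothesis cov : forall v, exists2 e, e \in E & v \in e.
Hypothesis p2 : forall S : {set V}, #|S| = q.+1 ->
  exists v w e, [/\ v \in S, w \in S, v != w & [/\ e \in E, v \in e & w \in e]].

Let inter (v w : V) := [exists e in E, (v \in e) && (w \in e)].
Let wit (v w : V) := odflt set0 [pick e in E | (v \in e) && (w \in e)].

Let witP v w : inter v w -> [/\ wit v w \in E, v \in wit v w & w \in wit v w].
Proof.
move=> /exists_inP[e eE /andP[ve we]]; rewrite /wit.
by case: pickP => [e' /and3P[] //|/(_ e)]; rewrite eE ve we.
Qed.

Let meet (t : nat) (f : {ffun 'I_t -> U}) : rel 'I_t :=
  fun i j => (i != j) && inter (g (f i)) (g (f j)).
(** The chosen witness contains no third draw, so it cuts out a Delaunay edge on the sampled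
    vertices, unless both draws are the same vertex. *)
Let good (t : nat) (f : {ffun 'I_t -> U}) : rel 'I_t := fun i j =>
  meet f i j &&
  [forall l, (g (f l) \in wit (g (f i)) (g (f j))) ==> ((l == i) || (l == j))].

(** Good pairs of distinct vertices inject into ordered Delaunay pairs. A good pair of equal
    vertices is determined by its first index, because the witness would contain any third copy. *)
Let good_pairs t (f : {ffun 'I_t -> U}) : 
  \sum_i \sum_j good f i j <= (4 * c).+1 * t.
Proof.
case: (posnP t) => [t0|t0]; first by subst t; rewrite big_ord0.
pose gf i := g (f i).
have goodP i j l : good f i j -> gf l = gf i \/ gf l = gf j -> l = i \/ l = j.
  move=> /andP[/andP[_ /witP[_ hi hj]] /forallP/(_ l)/implyP h] gl.
  suff /h : gf l \in wit (gf i) (gf j) by case/orP => /eqP; [left|right].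
  by case: gl => ->.
pose S := [set gf i | i : 'I_t].
have S0 : 0 < #|S| by apply/card_gt0P; exists (gf (Ordinal t0)); apply: imset_f.
have St : #|S| <= t by rewrite -[leqRHS]card_ord leq_imset_card.
pose G := [set ij : 'I_t * 'I_t | good f ij.1 ij.2 && (gf ij.1 != gf ij.2)].
pose Q := [set ij : 'I_t * 'I_t | good f ij.1 ij.2 && (gf ij.1 == gf ij.2)].
have -> : \sum_i \sum_j good f i j = #|Q| + #|G|.
  rewrite pair_big /= -!sum1_card.
  rewrite [X in X + _]big_mkcond [X in _ + X]big_mkcond -big_split /=.
  apply: eq_bigr => -[i j] _; rewrite !inE /=.
  by case: good; case: eqP.
have hQ : #|Q| <= t.
  rewrite -(@card_in_imset _ _ fst Q).
    by rewrite -[leqRHS]card_ord max_card.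
  move=> [i j] [i' j'] /=; rewrite !inE /=.
  move=> /andP[gij /eqP eij] /andP[gij' /eqP eij'] ii.
  subst i'; congr pair; have /andP[/andP[ij' _] _] := gij'.
  have := goodP i j j' gij (or_introl (esym eij')).
  by case=> // ji; rewrite ji eqxx in ij'.
have hG : #|G| <= 4 * c * #|S|.
  rewrite -(@card_in_imset _ _ (fun ij => (gf ij.1, gf ij.2)) G); last first.
    move=> [i j] [i' j'] /=; rewrite !inE /= => /andP[gij eij] /andP[gij' eij'] [ei ej].
    have [?|ii] := goodP i j i' gij (or_introl (esym ei)); last first.
      by rewrite ei ii eqxx in eij.
    have [jj|?] := goodP i j j' gij (or_intror (esym ej)); last by congr pair.
    by rewrite ej jj eqxx in eij.
  apply: (delaunay_pairs lin S0) => v w /imsetP[[i j]].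
  rewrite inE /= => /andP[gij eij] [-> ->].
  split=> //; have /andP[/andP[_ /witP[hE hi hj]] _] := gij.
  exists (wit (gf i) (gf j)) => //; apply/setP => z; rewrite !inE.
  apply/andP/orP => [[zw /imsetP[l _ zl]]|].
    have /andP[_ /forallP/(_ l)/implyP] := gij; rewrite -/(gf l) -zl => /(_ zw).
    by rewrite zl; case/orP => /eqP ->; [left|right].
  by case=> /eqP ->; split=> //; apply: imset_f.
rewrite mulSn; apply: leq_add => //; apply: leq_trans hG _.
by rewrite leq_mul2l St orbT.
Qed.

(** Among [q.+1] draws, either a vertex repeats, and by [cov] it meets itself, or [p2] applies to
    the image. *)
Let meet_pairs k t (f : {ffun 'I_t -> U}) : 
  k * (t - k * q) <= \sum_i \sum_j meet f i j.
Proof.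
have interC : symmetric inter.
  by move=> v w; apply: eq_existsb => e; rewrite [(v \in e) && _]andbC.
have := @turan_pairs _ (meet f) q _ _ _ k [set: 'I_t].
rewrite cardsT card_ord.
under [X in _ -> _ -> _ -> _ <= X]eq_bigl do rewrite inE.
under [X in _ -> _ -> _ -> _ <= X]eq_bigr do under eq_bigl do rewrite inE.
apply.
- by move=> i j; rewrite /meet eq_sym interC.
- by move=> i; rewrite /meet eqxx.
move=> S Sq.
have [/dinjectiveP gI|/dinjectivePn[i iS [j /andP[/= ji jS] gij]]] :=
    boolP (dinjectiveb (fun i => g (f i)) (mem S)); last first.
  exists i, j; rewrite iS jS /meet eq_sym ji -gij; split=> //.
  by have [e eE ie] := cov (g (f i)); apply/exists_inP; exists e; rewrite ?ie.
have [|v [w [e [/imsetP[i iS ->] /imsetP[j jS ->] vw [eE ve we]]]]] :=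
    p2 (S := [set g (f i) | i in S]).
  by rewrite card_in_imset.
exists i, j; split=> //; rewrite /meet; apply/andP; split.
  by apply: contra_neq vw => ->.
by apply/exists_inP; exists e; rewrite ?ve.
Qed.

(** The weight of a vertex is the size of its fibre under [g], so uniform draws from [U] are
    weighted draws of vertices. *)
Lemma heavy_edge : 0 < q -> 0 < #|U| ->
  exists2 e, e \in E &
    #|U| <= 16 * (4 * c).+2 * q * #|[set u | g u \in e]|.
Proof.
(* With [t = 2 * K * q], Turan gives [K * (K * q)] meeting pairs per sample; [K] is taken just large
   enough to exceed twice the bound on good pairs. *)
move=> q0 U0; set K := 4 * (4 * c).+2; set t := 2 * K * q.
have -> : 16 * (4 * c).+2 * q = 2 * t by rewrite /t /K; lia.
apply/exists_inP; rewrite -[X in is_true X]negbK; apply/negP.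
rewrite negb_exists_in => /forall_inP light.
have {}light e : e \in E -> 2 * t * #|[set u | g u \in e]| <= #|U|.
  by move=> /light; rewrite -ltnNge => /ltnW.
pose hits (f : {ffun 'I_t -> U}) i j l := (meet f i j : nat) * ((l != i) && (l != j)) *
   (g (f l) \in wit (g (f i)) (g (f j))).
have hitsP (f : {ffun 'I_t -> U}) i j :
    (meet f i j : nat) <= good f i j + \sum_l hits f i j l.
  rewrite /good; case m: meet => //=.
  case: forallP => //= /forallP; rewrite negb_forall => /existsP[l].
  rewrite negb_imply negb_or => /andP[lw /andP[li lj]].
  by rewrite (bigD1 l) //= /hits m li lj lw.
(* The witness depends only on draws [i] and [j], so draw [l] may be resampled; lightness then
   bounds its chance of hitting the witness by 1/(2t). *)
have rare i j l : 2 * t * \sum_(f : {ffun 'I_t -> U}) hits f i j l <= 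
    \sum_(f : {ffun 'I_t -> U}) (meet f i j : nat).
  have [|lij] := boolP ((l != i) && (l != j)); last first.
    by rewrite big1 ?muln0 // => f _; rewrite /hits (negPf lij) muln0.
  move=> /andP[li lj].
  rewrite -(leq_pmul2l U0) mulnCA.
  pose h (f : {ffun 'I_t -> U}) u := (meet f i j : nat) * 
    (g u \in wit (g (f i)) (g (f j))).
  rewrite [X in _ * (_ * X)](_ : _ = \sum_f h f (f l)); last first.
    by apply: eq_bigr => f _; rewrite /hits /h li lj muln1.
  rewrite resample; last first.
    by move=> f f' ff' u; rewrite /h /meet !ff' // eq_sym.
  rewrite !big_distrr /=; apply: leq_sum => f _.
  rewrite -big_distrr /= mulnCA [leqRHS]mulnC leq_mul2l.
  case m: meet => //=; rewrite ?mul1n.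
  have /andP[_ /witP[/light wE _ _]] := m.
  by rewrite -sum1dep_card big_mkcond in wE; exact: wE.
have t0 : 0 < t by rewrite /t /K; lia.
set A := \sum_(f : {ffun 'I_t -> U}) \sum_i \sum_j (meet f i j : nat).
set G := \sum_(f : {ffun 'I_t -> U}) \sum_i \sum_j (good f i j : nat).
set H := \sum_(f : {ffun 'I_t -> U}) \sum_i \sum_j \sum_l hits f i j l.
have AGH : A <= G + H.
  rewrite -big_split; apply: leq_sum => f _ /=.
  rewrite -big_split; apply: leq_sum => i _ /=.
  by rewrite -big_split; apply: leq_sum => j _ /=.
have HA : 2 * H <= A.
  rewrite -(leq_pmul2l t0) mulnA [t * 2]mulnC.
  rewrite /H /A exchange_big [X in _ <= _ * X]exchange_big /= !big_distrr /=.
  apply: leq_sum => i _.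
  rewrite exchange_big [X in _ <= _ * X]exchange_big /= !big_distrr /=.
  apply: leq_sum => j _.
  rewrite exchange_big /= big_distrr /=.
  rewrite -[X in _ <= X * _](card_ord t) -sum_nat_const.
  by apply: leq_sum => l _; apply: rare.
have GU : G <= #|{ffun 'I_t -> U}| * ((4 * c).+1 * t).
  by rewrite -sum_nat_const; apply: leq_sum => f _; apply: good_pairs.
have AU : #|{ffun 'I_t -> U}| * (K * (t - K * q)) <= A.
  by rewrite -sum_nat_const; apply: leq_sum => f _; apply: meet_pairs.
have N0 : 0 < #|{ffun 'I_t -> U}| by rewrite card_ffun expn_gt0 U0.
(* [A <= G + H] and [2 * H <= A] give [A <= 2 * G], which the choice of [K] contradicts. *)
have : #|{ffun 'I_t -> U}| * (K * (t - K * q)) <=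
       #|{ffun 'I_t -> U}| * (2 * ((4 * c).+1 * t)) by lia.
rewrite leq_pmul2l // (_ : t - K * q = K * q); last by rewrite /t; lia.
rewrite (_ : 2 * ((4 * c).+1 * t) = 4 * (4 * c).+1 * (K * q)); last by rewrite /t; lia.
by rewrite leq_pmul2r ?muln_gt0 ?q0 /K; lia.
Qed.

End HeavyEdge.

(** * Multiplicative weights *)

Lemma bernoulli_expn N m : N ^ m * (N + m) <= N * N.+1 ^ m.
Proof.
elim: m => [|m IH]; first by rewrite !expn0 mul1n muln1 addn0.
rewrite !expnS; nia.
Qed.

(** This is (1 + 1/N)^N >= 2, from Bernoulli's inequality with exponent [N]. *)
Lemma double_expn_succ N : 0 < N -> 2 * N ^ N <= N.+1 ^ N.
Proof.
move=> N0; rewrite -(leq_pmul2l N0).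
by apply: leq_trans (bernoulli_expn N N); rewrite addnn -muln2; lia.
Qed.

(* Repeatedly add a heavy e to T, doubling the weight of every vertex that e misses:
   the total weight grows by a factor at most 2 - 1/M per step, while a vertex hit
   rarely would have weight close to 2 ^ size T. *)
Lemma multiplicative_weights (V : finType) (E : {set {set V}}) (M : nat) :
    0 < M ->
    (forall w : V -> nat, 0 < \sum_v w v ->
       exists2 e, e \in E & \sum_v w v <= M * \sum_(v in e) w v) ->
  exists T : seq {set V}, [/\ all [in E] T, size T = 4 * M * #|V| &
    forall v, size T <= 4 * M * count (fun e : {set V} => v \in e) T].
Proof.
move=> M0 heavy.
have [V0|V0] := posnP #|V|.
  by exists [::]; split=> //; rewrite V0 muln0.
(* The invariant without denominators: after [j] steps the total weight is at most (2 - 1/M)^j times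
   [#|V|]. *)
have step j : exists T : seq {set V}, [/\ all [in E] T, size T = j &
    M ^ j * \sum_v 2 ^ count (fun e : {set V} => v \notin e) T <= (2 * M).-1 ^ j * #|V|].
  elim: j => [|j [T [TE Tj IH]]].
    by exists [::]; split=> //=; rewrite sum_nat_const muln1.
  pose w v := 2 ^ count (fun e : {set V} => v \notin e) T.
  have [|e eE he] := heavy w.
    have /card_gt0P[v _] := V0.
    by rewrite (bigD1 v) //= addn_gt0 expn_gt0.
  exists (e :: T); rewrite /= eE TE Tj; split=> //.
  set W := \sum_v w v in he *; set D := \sum_(v in e) w v in he *.
  have -> : \sum_v 2 ^ ((v \notin e) + count (fun e : {set V} => v \notin e) T) = 2 * W - D.
    suff : \sum_v 2 ^ ((v \notin e) + count (fun e : {set V} => v \notin e) T) + D = 2 * W by lia.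
    rewrite /D [X in _ + X]big_mkcond -big_split big_distrr /=; apply: eq_bigr => v _.
    by case: (v \in e); rewrite /= expnD /w; lia.
  rewrite -/W in IH.
  have : M * (2 * W - D) <= (2 * M).-1 * W by nia.
  rewrite !expnS => /(leq_mul (leqnn (M ^ j))) h.
  rewrite mulnAC mulnC; apply: leq_trans h _.
  by rewrite mulnCA -[leqRHS]mulnA leq_mul2l IH orbT.
have [T [TE Tj Tb]] := step (4 * M * #|V|).
exists T; split=> // v.
set n := #|V| in V0 step Tj *; set j := 4 * M * n in Tj *.
set h := count _ T.
have hj : h + count (fun e : {set V} => v \notin e) T = j.
  by rewrite -Tj -(count_predC (fun e : {set V} => v \in e)).
suff : n <= h by rewrite Tj /j; nia.
(* The weight of [v] alone, 2^(j - h), is at most the total weight. *)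
have b1 : (2 * M) ^ j <= 2 ^ h * ((2 * M).-1 ^ j * n).
  rewrite expnMn -{1}hj expnD -mulnA leq_mul2l mulnC; apply/orP; right.
  apply: leq_trans Tb; rewrite leq_mul2l; apply/orP; right.
  by rewrite (bigD1 v) //= leq_addr.
(* The [j] factors 2M/(2M - 1) form [2 * n] blocks of length [2 * M], and each block at least
   doubles. *)
have b2 : 2 ^ (2 * n) * (2 * M).-1 ^ j <= (2 * M) ^ j.
  have -> : j = 2 * M * (2 * n) by rewrite /j; lia.
  rewrite !(expnM _ (2 * M)) -expnMn leq_exp2r; last by lia.
  have [N NM] : exists N, 2 * M = N.+2 by exists (2 * M - 2); lia.
  rewrite NM /= [N.+1 ^ _]expnS [N.+2 ^ _]expnS.
  by have := @double_expn_succ N.+1 isT; nia.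
have : 2 ^ (2 * n) <= 2 ^ h * n.
  have P0 : 0 < (2 * M).-1 ^ j by rewrite expn_gt0; lia.
  by rewrite -(leq_pmul2r P0); apply: leq_trans b2 _; apply: leq_trans b1 _; lia.
move=> hn; have : 2 ^ (2 * n) < 2 ^ (h + n).
  by apply: leq_ltn_trans hn _; rewrite expnD ltn_pmul2l ?expn_gt0 // ltn_expl.
by rewrite ltn_exp2l //; lia.
Qed.

(** * Traces, shattering and the Sauer-Shelah bound *)

Section Traces.
Variable V : finType.
Implicit Types (G : {set V}) (ys zs : seq {set V}).

(** Hyperedges are the ground elements and vertices the traced sets. [G] is cut into cells by
    membership, and the nonempty cells are counted. *)
Fixpoint ntraces G zs : nat :=
  if zs is z :: zs' then ntraces (G :&: z) zs' + ntraces (G :\: z) zs'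
  else G != set0.

(** All cells must be nonempty, so a list with a repetition is never shattered. *)
Fixpoint shatters G ys : bool :=
  if ys is y :: ys' then shatters (G :&: y) ys' && shatters (G :\: y) ys'
  else G != set0.

(** Subsequences are counted by position; the elements already chosen are absorbed into [Q]. *)
Fixpoint nsubseqs (Q : pred (seq {set V})) zs : nat :=
  if zs is z :: zs' then nsubseqs Q zs' + nsubseqs (fun ys => Q (z :: ys)) zs'
  else Q [::].

Lemma card_imset_ntraces (K : finType) (key : V -> K) G zs :
    {in G &, forall v w, (forall z, z \in zs -> (v \in z) = (w \in z)) ->
      key v = key w} ->
  #|[set key v | v in G]| <= ntraces G zs.
Proof.
elim: zs G => [|z zs IH] G hG /=.
  have [->|[v vG]] := set_0Vmem G; first by rewrite imset0 cards0.
  have -> : G != set0 by apply/set0Pn; exists v.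
  rewrite /= -(cards1 (key v)); apply/subset_leq_card/subsetP => k /imsetP[w wG ->].
  by rewrite inE; apply/eqP/hG.
rewrite -{1}(setID G z) imsetU; apply: leq_trans (leq_card_setU _ _) _.
apply: leq_add; apply: IH => v w; rewrite !inE => /andP[h1 h2] /andP[h3 h4] h.
- by apply: hG => // y; rewrite inE => /predU1P[->|/h//]; rewrite h2 h4.
- by apply: hG => // y; rewrite inE => /predU1P[->|/h//]; rewrite (negPf h1) (negPf h3).
Qed.

Lemma shattersS G G' ys : G \subset G' -> shatters G ys -> shatters G' ys.
Proof.
elim: ys G G' => [|y ys IH] G G' GG' /=.
  by apply: contraNN => /eqP G0; rewrite -subset0 -G0.
by case/andP=> /(IH _ _ (setSI y GG'))-> /(IH _ _ (setSD y GG'))->.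
Qed.

Lemma shatters_pattern G ys m : shatters G ys -> size m = size ys ->
  exists2 v, v \in G & [seq v \in y | y : {set V} <- ys] = m.
Proof.
elim: ys G m => [|y ys IH] G [|b m] //=; first by case/set0Pn => v; exists v.
move=> /andP[sI sD] [sm]; case: b.
  have [v] := IH _ _ sI sm; rewrite inE => /andP[vG vy] <-.
  by exists v; rewrite ?vy.
have [v] := IH _ _ sD sm; rewrite inE => /andP[/negPf vy vG] <-.
by exists v; rewrite ?vy.
Qed.

Lemma nsubseqs_le (Q Q' : pred (seq {set V})) zs :
  (forall ys, Q ys -> Q' ys) -> nsubseqs Q zs <= nsubseqs Q' zs.
Proof.
elim: zs Q Q' => [|z zs IH] Q Q' QQ' /=.
  by have := QQ' [::]; case: (Q _) => // ->.
by apply: leq_add; apply: IH => // ys; apply: QQ'.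
Qed.

(** Serves Pajor's induction, with [Q] and [Q'] meaning shattered by [G :&: z] and by [G :\: z]: a
    list satisfying either is shattered by [G], and one satisfying both can be extended by [z]. *)
Lemma nsubseqsUI Q Q' zs :
  nsubseqs Q zs + nsubseqs Q' zs =
  nsubseqs (fun ys => Q ys || Q' ys) zs + nsubseqs (fun ys => Q ys && Q' ys) zs.
Proof.
elim: zs Q Q' => [|z zs IH] Q Q' /=; first by do 2 case: (_ [::]).
by rewrite addnACA IH (IH (fun ys => Q (z :: ys))) addnACA.
Qed.

(* Pajor's form of the Sauer-Shelah lemma. *)
Lemma ntraces_le_shattered G zs : ntraces G zs <= nsubseqs (shatters G) zs.
Proof.
elim: zs G => [|z zs IH] G //=.
apply: leq_trans (leq_add (IH _) (IH _)) _; rewrite nsubseqsUI leq_add2r.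
apply: nsubseqs_le => ys /orP[]; apply: shattersS; first exact: subsetIl.
exact: subsetDl.
Qed.

(** Pascal's recursion: once [z] is chosen, at most [D - 1] further elements remain. *)
Lemma nsubseqs_bound (a : pred {set V}) (Q : pred (seq {set V})) (D : nat) zs :
    (forall ys, all a ys -> Q ys -> size ys <= D) -> all a zs ->
  nsubseqs Q zs <= (size zs).+1 ^ D.
Proof.
have none Q' ys : (forall ys, all a ys -> ~~ Q' ys) -> all a ys -> nsubseqs Q' ys = 0.
  elim: ys Q' => [|y ys IH] Q' nQ /=; first by move/negPf: (nQ [::] isT) => ->.
  case/andP=> ay ays; rewrite !IH // => ys' ays'; apply: nQ => //=.
  by rewrite ay.
elim: zs Q D => [|z zs IH] Q D hQ /=; first by rewrite exp1n; case: (Q _).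
case/andP=> az azs; case: D hQ => [|D] hQ.
  rewrite (none (fun ys => Q (z :: ys)) zs _ azs) ?addn0; last first.
    move=> ys ays; apply/negP => Qy.
    by have := hQ (z :: ys); rewrite /= az ays Qy ltn0 => /(_ isT isT).
  by have := IH Q 0 hQ azs; rewrite !expn0.
have h1 := IH Q D.+1 hQ azs.
have h2 : nsubseqs (fun ys => Q (z :: ys)) zs <= (size zs).+1 ^ D.
  by apply: IH => // ys ays Qy; have := hQ (z :: ys); rewrite /= az ays; apply.
apply: leq_trans (leq_add h1 h2) _.
rewrite expnS -mulSnr expnS leq_mul //.
by case: {IH hQ h1 h2} D => // D; rewrite leq_exp2r.
Qed.

End Traces.

Lemma leq_expl m n e : m <= n -> m ^ e <= n ^ e.
Proof. by case: e => // e mn; rewrite leq_exp2r. Qed.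

(** [k * k] shattered hyperedges would give a complete Delaunay graph on [k] vertices, whose
    [k * k.-1] ordered pairs exceed [4 * c * k] when [k = (4 * c).+2]. *)
Lemma shatters_size (V : finType) (E : {set {set V}}) (c : nat) (ys : seq {set V}) :
    hered_linear E c -> all [in E] ys -> shatters [set: V] ys ->
  size ys < (4 * c).+2 ^ 2.
Proof.
move=> lin /allP ysE sh; rewrite ltnNge; apply/negP; set k := (4 * c).+2 => kys.
have pos (i j : 'I_k) : i * k + j < size ys.
  by apply: leq_trans kys; have := ltn_ord i; have := ltn_ord j; nia.
(* The list is read as a grid. Vertex [f l] will lie exactly in row [l] and column [l], so [y i j]
   contains only [f i] and [f j] among the chosen vertices. *)
pose y (i j : 'I_k) := nth set0 ys (i * k + j).
have yE i j : y i j \in E by apply/ysE/mem_nth.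
have /fin_all_exists[f fP] (l : 'I_k) :
    exists v, forall i j, (v \in y i j) = (i == l) || (j == l).
  pose m := mkseq (fun n => (n %/ k == l) || (n %% k == l)) (size ys).
  have [|v _ vm] := shatters_pattern (m := m) sh; first by rewrite size_mkseq.
  exists v => i j; rewrite -(nth_map _ false (fun y : {set V} => v \in y)) ?pos //.
  by rewrite vm nth_mkseq ?pos // divnMDl // divn_small // addn0 modnMDl modn_small.
have fI : injective f.
  move=> l l' ll; have := fP l l l; rewrite ll fP eqxx /= orbb.
  by move/eqP.
pose S := [set f l | l : 'I_k].
have Sk : #|S| = k by rewrite card_imset // card_ord.
pose J := [set ij : 'I_k * 'I_k | ij.1 != ij.2].
have Jk : #|J| = k * k.-1.
  rewrite -sum1dep_card -(pair_big_dep predT (fun i j => i != j) (fun=> fun=> 1)) /=.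
  rewrite (eq_bigr (fun=> k.-1)) ?sum_nat_const ?card_ord // => i _.
  rewrite sum1dep_card -[k in RHS]card_ord -(cardC1 i); apply: eq_card => j.
  by rewrite !inE eq_sym.
have : #|[set (f ij.1, f ij.2) | ij in J]| <= 4 * c * #|S|.
  apply: (delaunay_pairs lin); first by rewrite Sk.
  move=> v w /imsetP[[i j]]; rewrite inE /= => ij [-> ->]; split.
    by rewrite (inj_eq fI).
  exists (y i j) => //; apply/setP => z; rewrite !inE.
  apply/andP/orP => [[zy /imsetP[l _ zl]]|[]/eqP->].
  - by move: zy; rewrite zl fP => /orP[]/eqP->; [left|right].
  - by rewrite fP eqxx imset_f.
  - by rewrite fP eqxx orbT imset_f.
rewrite card_in_imset; last by move=> [i j] [i' j'] _ _ [] /fI-> /fI->.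
by rewrite Jk Sk /k; nia.
Qed.

(** * Nets by double sampling *)

Section DoubleSampling.
Variables (V Y : finType) (h : Y -> {set V}) (s : nat).
Let sample := {ffun 'I_s -> Y}.

Definition dtrace (z : sample * sample) (v : V) : {ffun 'I_s -> bool * bool} :=
  [ffun i => (v \in h (z.1 i), v \in h (z.2 i))].

(* A vertex missed by the first sample scores 2 ^ (its hits in the second one); the
   average of this score replaces the tail estimate of the usual net argument. *)
Let pot (tau : {ffun 'I_s -> bool * bool}) :=
  \prod_i (if (tau i).1 then 0 else 2 ^ (tau i).2).

Let swap (T : Type) (b : bool) (x : T * T) := if b then (x.2, x.1) else x.

Let swapz (sg : {ffun 'I_s -> bool}) (z : sample * sample) : sample * sample :=
  ([ffun i => (swap (sg i) (z.1 i, z.2 i)).1],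
   [ffun i => (swap (sg i) (z.1 i, z.2 i)).2]).

(** The sum factors over coordinates; the two orders of one coordinate contribute 1 + 1, 0 + 2 or 0
    + 0, never more than 2. *)
Let sum_swap_pot tau :
  \sum_(sg : {ffun 'I_s -> bool}) pot [ffun i => swap (sg i) (tau i)] <= 2 ^ s.
Proof.
pose F i b := if (swap b (tau i)).1 then 0 else 2 ^ (swap b (tau i)).2.
rewrite (eq_bigr (fun sg : {ffun 'I_s -> bool} => \prod_i F i (sg i))); last first.
  by move=> sg _; rewrite /pot; apply: eq_bigr => i _; rewrite ffunE.
rewrite -bigA_distr_bigA -[s in leqRHS]card_ord -prod_nat_const.
apply: leq_prod => i _; rewrite big_bool /F /swap.
by case: (tau i) => -[] [].
Qed.

(** If every sample [f] missed a vertex [b f], the best score [Psi] would average at least (1 +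
    1/N)^s over double samples, while random swaps bound its average by [r]. *)
Lemma small_net (N r : nat) :
    0 < #|Y| -> (forall v, #|Y| <= N * #|[set y | v \in h y]|) ->
    (forall z, #|[set dtrace z v | v : V]| <= r) -> r * N ^ s < N.+1 ^ s ->
  exists f : sample, forall v, exists i, v \in h (f i).
Proof.
move=> Y0 heavy tr rs.
suff : [exists f : sample, [forall v, [exists i, v \in h (f i)]]].
  case/existsP => f /forallP hf; exists f => v; exact/existsP.
rewrite -[X in is_true X]negbK; apply/negP; rewrite negb_exists => /forallP miss.
have /fin_all_exists[b bP] (f : sample) : exists v, forall i, v \notin h (f i).
  have /forallPn[v /existsPn nv] := miss f; by exists v.
pose Psi z := \max_v pot (dtrace z v).
have Psi_swap z : \sum_sg Psi (swapz sg z) <= r * 2 ^ s.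
  apply: (@leq_trans (\sum_(sg : {ffun 'I_s -> bool})
      \sum_(tau in [set dtrace z v | v : V]) pot [ffun i => swap (sg i) (tau i)])).
    apply: leq_sum => sg _; apply/bigmax_leqP => v _.
    rewrite (bigD1 (dtrace z v)) ?imset_f //=; apply: leq_trans (leq_addr _ _).
    rewrite [X in pot X <= _](_ : _ = [ffun i => swap (sg i) (dtrace z v i)]) //.
    by apply/ffunP => i; rewrite !ffunE /= ?ffunE /swap; case: (sg i).
  rewrite exchange_big /=.
  apply: (@leq_trans (\sum_(tau in [set dtrace z v | v : V]) 2 ^ s)).
    by apply: leq_sum => tau _; apply: sum_swap_pot.
  by rewrite sum_nat_const leq_mul2r tr orbT.
have swapzK sg : involutive (swapz sg).
  move=> [f f']; congr pair; apply/ffunP => i; rewrite !ffunE /= ?ffunE /swap;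
  by case: (sg i).
have card_sample : #|{: sample}| = #|Y| ^ s by rewrite card_ffun card_ord.
have upper : \sum_z Psi z <= #|Y| ^ s * #|Y| ^ s * r.
  have s2 : 0 < 2 ^ s by rewrite expn_gt0.
  rewrite -(leq_pmul2l s2).
  rewrite -[X in X * \sum_z _ <= _](_ : #|{ffun 'I_s -> bool}| = _); last first.
    by rewrite card_ffun card_bool card_ord.
  rewrite -sum_nat_const.
  rewrite (eq_bigr (fun sg => \sum_z Psi (swapz sg z))); last first.
    by move=> sg _; rewrite (reindex_inj (inv_inj (swapzK sg))).
  rewrite exchange_big /= mulnCA [2 ^ s * r]mulnC -card_sample -card_prod -sum_nat_const.
  by apply: leq_sum => z _; apply: Psi_swap.
have lower : #|Y| ^ s * (N.+1 * #|Y|) ^ s <= N ^ s * \sum_z Psi z.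
  rewrite -(pair_big predT predT (fun f f' => Psi (f, f'))) /=.
  rewrite -card_sample -sum_nat_const big_distrr /=; apply: leq_sum => f _.
  (* For fixed [f], the sum over [f'] factors over coordinates, each factor being at least (1 + 1/N)
     times [#|Y|]. *)
  apply: (@leq_trans (N ^ s * \sum_(f' : sample) \prod_i 2 ^ (b f \in h (f' i)))).
    rewrite -(bigA_distr_bigA (fun i y => 2 ^ (b f \in h y))) /=.
    rewrite prod_nat_const card_ord -expnMn.
    apply: leq_expl.
    rewrite (eq_bigr (fun y => 1 + (b f \in h y))); last by move=> y _; case: (_ \in _).
    rewrite big_split /= sum1_card mulnDr mulSn addnC leq_add2l.
    by have := heavy (b f); rewrite -sum1dep_card big_mkcond.
  rewrite leq_mul2l; apply/orP; right; apply: leq_sum => f' _.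
  rewrite /Psi (bigD1 (b f)) //=; apply: leq_trans (leq_maxl _ _).
  by apply: eq_leq; apply: eq_bigr => i _; rewrite ffunE /= (negPf (bP f i)).
have Ys : 0 < #|Y| ^ s by rewrite expn_gt0 Y0.
move: rs; rewrite ltnNge => /negP; apply.
rewrite -(leq_pmul2r Ys) -(leq_pmul2l Ys).
have := leq_trans lower (leq_mul (leqnn _) upper); rewrite expnMn.
by move: (#|Y| ^ s) (N.+1 ^ s) (N ^ s) => x y z; lia.
Qed.

End DoubleSampling.

(** * Numerical choice of the net size *)

Lemma expn_beats_poly q D : exists2 A, 0 < A & (q * A) ^ D < 2 ^ A.
Proof.
(* As [q * A <= 2 ^ (q + (2 * x + 2))], it remains to compare exponents: (3x + 2)x < 4 * 4^x. *)
set x := q + D; exists (2 ^ (2 * x + 2)); first by rewrite expn_gt0.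
apply: (@leq_ltn_trans ((2 ^ (q + (2 * x + 2))) ^ D)).
  by apply: leq_expl; rewrite [2 ^ (q + _)]expnD leq_mul2r ltnW ?orbT // ltn_expl.
rewrite -expnM ltn_exp2l // expnD mul2n -addnn expnD -[2 ^ 2]/4.
have : x < 2 ^ x by rewrite ltn_expl.
move: (2 ^ x) => y xy; apply: (@leq_ltn_trans ((3 * x + 2) * x)).
  by apply: leq_mul; rewrite /x; lia.
nia.
Qed.

(** For samples of size [s = N * (A * trunc_log 2 p)], the left side will bound the traces on a
    double sample. *)
Lemma net_size_bound B D : 0 < B -> exists2 A, 0 < A & forall p N, 2 <= p -> N <= B * p ->
  (2 * (N * (A * trunc_log 2 p))).+1 ^ D < 2 ^ (A * trunc_log 2 p).
Proof.
move=> B0; have [A A0 hA] := expn_beats_poly (24 * B) D.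
exists A => // p N p2 NB; set L := trunc_log 2 p.
have L0 : 0 < L by rewrite trunc_log_gt0.
have pL : p < 2 ^ L.+1 by apply: trunc_log_ltn.
have LL : L < 2 ^ L by rewrite ltn_expl.
rewrite [ltnRHS]expnM; apply: (@leq_ltn_trans (((24 * B * A) ^ D) ^ L)); last first.
  by rewrite ltn_exp2r.
rewrite -expnM [D * L]mulnC expnM; apply: leq_expl.
(* Uses [p < 2 ^ L.+1] and [L < 2 ^ L]. The constant 24 is 6 times 4: it absorbs 4^L, and [L >= 1]
   covers the factor [6 * B * A]. *)
apply: (@leq_trans (6 * B * A * (2 ^ L * 2 ^ L))).
  move: pL; rewrite expnS; move: (2 ^ L) LL => x LL pL.
  have h1 : N * (A * L) <= B * p * (A * L) by rewrite leq_mul2r NB orbT.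
  have h2 : p * L <= 2 * x * x by apply: leq_mul; lia.
  have h3 : B * A * (p * L) <= B * A * (2 * x * x) by rewrite leq_mul2l h2 orbT.
  have h4 : 0 < B * A * (x * x) by rewrite !muln_gt0 B0 A0; lia.
  by lia.
rewrite -expnMn -[2 * 2]/4 (_ : 24 * B * A = 6 * B * A * 4); last by lia.
rewrite expnMn leq_mul2r -{1}[6 * B * A]expn1 leq_pexp2l ?orbT //.
by rewrite !muln_gt0 B0 A0.
Qed.

(** * The transversal bound for abstract hypergraphs *)

Lemma hypergraph_p2 (c : nat) : exists A,
  forall (V : finType) (E : {set {set V}}) (p : nat),
    2 <= p -> hered_linear E c -> (forall v, exists2 e, e \in E & v \in e) ->
    (forall S : {set V}, #|S| = p ->
       exists v w e, [/\ v \in S, w \in S, v != w & [/\ e \in E, v \in e & w \in e]]) ->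
  exists T : seq {set V}, [/\ all [in E] T, forall v, exists2 e, e \in T & v \in e &
    size T <= A * (p * trunc_log 2 p)].
Proof.
(* [D] bounds the length of shattered lists, and [B * q] is the inverse hitting frequency [N]
   below. *)
pose D := (4 * c).+2 ^ 2; pose B := 64 * (4 * c).+2.
have [A A0 hA] := @net_size_bound B D isT.
exists (B * A) => V E [//|q] p2 lin cov pE.
pose M := 16 * (4 * c).+2 * q; pose N := 4 * M.
have q0 : 0 < q by lia.
have M0 : 0 < M by rewrite /M; lia.
have [w w0|T [TE Ts Tv]] := @multiplicative_weights V E M M0.
  (* Integer weights become multiplicities: [U] holds [w v] copies of [v]. *)
  pose U := {v : V & 'I_(w v)}.
  have sumU (P : pred V) : \sum_(v | P v) w v = #|[set u : U | P (tag u)]|.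
    rewrite (eq_bigr (fun v => \sum_(j : 'I_(w v)) 1)); last first.
      by move=> v _; rewrite sum1_card card_ord.
    rewrite (sig_big_dep P (fun v => xpredT) (fun v _ => 1)) -sum1dep_card.
    by apply: eq_bigl => u; rewrite andbT.
  have [|e eE e0] := heavy_edge (@tag V (fun v => 'I_(w v))) lin cov pE q0.
    by rewrite -cardsT; move: w0; rewrite sumU.
  by exists e => //; rewrite !sumU; move: e0; rewrite -cardsT.
have [V0|V0] := posnP #|V|.
  by exists [::]; split=> // v; have := fintype0 v V0.
have T0 : 0 < size T by rewrite Ts !muln_gt0 V0 andbT; move: M0; rewrite /M !muln_gt0.
(* Sampling positions of [T] keeps the multiplicities of its hyperedges. *)
pose h (y : 'I_(size T)) := nth set0 T y.
have hE y : h y \in E by apply: (allP TE); apply: mem_nth.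
pose s := N * (A * trunc_log 2 q.+1).
have [|v|z||f fP] := @small_net V _ h s N ((2 * s).+1 ^ D).
- by rewrite card_ord.
- rewrite card_ord; apply: leq_trans (Tv v) _; rewrite leq_mul2l; apply/orP; right.
  by rewrite -sum1_count (big_nth set0) big_mkord sum1dep_card.
(* The [2 * s] hyperedges of the double sample determine [dtrace], so Pajor's bound applies to this
   list. *)
- pose zs := [seq h (z.1 i) | i : 'I_s] ++ [seq h (z.2 i) | i : 'I_s].
  have zE : all [in E] zs.
    by rewrite all_cat; apply/andP; split; apply/allP => e /mapP[i _ ->]; apply: hE.
  have -> : 2 * s = size zs by rewrite size_cat !size_map -enumT size_enum_ord; lia.
  apply: leq_trans (nsubseqs_bound (Q := shatters [set: V]) _ zE); last first.
    by move=> ys yE /(shatters_size lin yE)/ltnW.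
  apply: leq_trans (ntraces_le_shattered _ _).
  rewrite -[X in X <= _](_ : #|[set dtrace h z v | v in [set: V]]| = _); last first.
    congr #|pred_of_set _|; apply/setP => x.
    by apply/imsetP/imsetP => -[v _ ->]; exists v; rewrite ?inE.
  apply: card_imset_ntraces => v w _ _ vw; apply/ffunP => i; rewrite !ffunE.
  congr pair; apply: vw; rewrite mem_cat; apply/orP; [left|right];
  by apply: map_f; rewrite mem_enum.
- have sD : (2 * s).+1 ^ D < 2 ^ (A * trunc_log 2 q.+1).
    by apply: hA => //; rewrite /N /M /B; lia.
  have N0 : 0 < N by rewrite muln_gt0.
  rewrite -(@ltn_pmul2r (N ^ s)) ?expn_gt0 ?N0 // in sD.
  apply: leq_trans sD _; rewrite /s !(expnM _ N) -expnMn.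
  (* As [s] is a multiple of [N], (1 + 1/N)^N >= 2 is raised to the power [A * trunc_log 2 q.+1]. *)
  exact/leq_expl/double_expn_succ.
exists [seq h (f i) | i : 'I_s]; split.
- by apply/allP => e /mapP[i _ ->]; apply: hE.
- by move=> v; have [i vi] := fP v; exists (h (f i)) => //;
  apply: map_f; rewrite mem_enum.
- rewrite size_image card_ord /s /N /M /B; lia.
Qed.

(* Return to regions of R^d *)
From mathcomp Require Import all_boot all_order all_algebra.
From mathcomp Require Import boolp classical_sets reals exp.
Import Order.TTheory GRing.Theory Num.Theory.
Local Open Scope ring_scope.
Local Open Scope classical_set_scope.

Theorem theorem2 (R : realType) (c : R) (hc : 0 < c) :
  exists C : R, forall (d n p : nat) (F : 'I_n -> set 'rV[R]_d),
    (2 <= p)%N ->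
    (forall i, F i !=set0) ->
    hered_c_linear_delaunay c F ->
    p2_property p F ->
    exists T : seq 'rV[R]_d, is_transversal_pts F T /\
      ((size T)%:R <= C * p%:R * ln p%:R)%R.
Proof.
have [A hA] := hypergraph_p2 (Num.bound c).
have ln2 : 0 < ln 2 :> R by rewrite ln_gt0 // ltr1n.
(* Division by [ln 2] passes from the truncated binary logarithm to [ln]. *)
exists (A%:R / ln 2) => d n p F p2 F0 lin pF.
pose edge x := dual_edge_in F [set: 'I_n]%SET x.
have edgeE x i : (i \in edge x) = `[< F i x >] by rewrite !finset.inE.
pose E := [set e : {set 'I_n} | `[< exists x, edge x = e >]]%SET.
have edgeP x : edge x \in E by rewrite finset.inE; apply/asboolP; exists x.
have [| |S Sp|T [TE Tcov Ts]] := hA 'I_n E p p2.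
- move=> S S0; have cb : c * #|S|%:R <= ((Num.bound c) * #|S|)%:R.
    by rewrite natrM ler_wpM2r // ltW // archi_boundP // ltW.
  rewrite -(@ler_nat R); apply: le_trans cb; apply: le_trans (ltW (lin S S0)).
  rewrite ler_nat; apply/fintype.subset_leq_card/fintype.subsetP => B; rewrite !finset.inE.
  case/andP=> -> /finset.imsetP[e]; rewrite finset.inE => /asboolP[x <-] ->.
  apply/asboolP; exists x; apply/finset.setP => i.
  by rewrite !finset.inE andbC.
- by move=> i; have [x Fx] := F0 i; exists (edge x); rewrite // edgeE; apply/asboolP.
- have [i [j [iS jS ij [x [Fi Fj]]]]] := pF S Sp.
  by exists i, j, (edge x); rewrite !edgeE; do 2!split=> //; apply/asboolP.
(* One point is chosen per hyperedge; the value 0 outside [E] is a dummy, as [T] lies in [E]. *)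
have /boolp.choice[pt ptP] (e : {set 'I_n}) : exists x, e \in E -> edge x = e.
  have [|_] := boolP (e \in E); last by exists 0.
  by rewrite finset.inE => /asboolP[x]; exists x.
exists (map pt T); split.
  move=> i; have [e eT ie] := Tcov i; exists (pt e); first exact: map_f.
  by apply/asboolP; rewrite -edgeE ptP // (allP TE).
rewrite size_map -mulrA mulrAC -mulrA.
apply: (@le_trans _ _ (A * (p * trunc_log 2 p))%:R); first by rewrite ler_nat.
rewrite !natrM ler_wpM2l // -mulrA ler_wpM2l // ler_pdivlMr //.
rewrite mulr_natl -lnXn ?ltr0n // ler_ln ?posrE ?exprn_gt0 ?ltr0n ?(leq_trans _ p2) //.
by rewrite -natrX ler_nat trunc_logP // (leq_trans _ p2).
Qed.
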